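(* Let $n>1$ and $k>0$ be integers. If at least one of the following conditions holds: (1) $n$ is odd; (2) $k$ is odd; (3) $n+1\equiv 0 \pmod 3$; (4) $\gcd(n+1,k+1)=1$; then the number $E_{n,k}$ is composite.
   Context: For integers $n\ge 0$, $k\ge 0$, the initial number $E_{n,k}$ is the natural number whose decimal expansion is obtained by writing the block ''$1$ followed by $k$ zeros'' $n$ times in succession and then appending a final digit $1$; that is, $E_{n,k}=\sum_{i=0}^{n}10^{(k+1)i}$. In particular $E_{0,k}=1$. *)

(* Defs.v *)
From mathcomp Require Import all_boot.

Set Implicit Arguments.
Unset Strict Implicit.
Unset Printing Implicit Defensive.

Definition E (n k : nat) : nat := \sum_(0 <= i < n.+1) 10 ^ (k.+1 * i).

Definition composite (m : nat) : bool := (1 < m) && ~~ prime m.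

(* Most significant digit first. *)
Definition of_digits (s : seq nat) : nat := foldl (fun a d => 10 * a + d) 0 s.

Definition E_digits (n k : nat) : seq nat :=
  flatten (nseq n (1 :: nseq k 0)) ++ [:: 1].

Lemma foldl_digits s a :
  foldl (fun a d => 10 * a + d) a s = a * 10 ^ size s + of_digits s.
Proof.
rewrite /of_digits; elim: s a => [|d s IHs] a /=; first by rewrite muln1 addn0.
by rewrite IHs (IHs (10 * 0 + d)) muln0 add0n mulnDl expnS (mulnC 10 a) -mulnA addnA.
Qed.

Lemma of_digits_cat s t :
  of_digits (s ++ t) = of_digits s * 10 ^ size t + of_digits t.
Proof. by rewrite {1}/of_digits foldl_cat foldl_digits. Qed.

Lemma of_digits_block k : of_digits (1 :: nseq k 0) = 10 ^ k.
Proof.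
rewrite -cat1s of_digits_cat size_nseq [of_digits [:: 1]]/= mul1n.
suff -> : of_digits (nseq k 0) = 0 by rewrite addn0.
by rewrite /of_digits; elim: k.
Qed.

Lemma of_digits_E n k : of_digits (E_digits n k) = E n k.
Proof.
have sz m : size (E_digits m k) = (k.+1 * m).+1.
  rewrite size_cat addn1; congr _.+1.
  by elim: m => [|m IHm] /=; rewrite ?muln0 // size_cat size_nseq IHm mulnS.
elim: n => [|n IHn]; first by rewrite /E big_nat1 muln0.
have -> : E_digits n.+1 k = (1 :: nseq k 0) ++ E_digits n k.
  by rewrite /E_digits /= catA.
rewrite of_digits_cat of_digits_block sz IHn /E [RHS]big_nat_recr //= addnC.
by rewrite -expnD mulnS addnS addSn.
Qed.

(* Main.v *)
Require Import Defs.
From mathcomp Require Import all_boot.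

(** [E n k] is a repunit: in base [10 ^ k.+1] it is written with [n.+1] ones.
    Write [R b N] for the repunit with [N] ones in base [b]. Grouping digits
    gives [R b (m * N) = R b m * R (b ^ m) N] ([repunitM]). Each hypothesis
    yields a proper divisor, in all cases but one through this identity.

    - If [N] is even, [R b 2 = b + 1] divides [R b N].
    - If [N] is divisible by 3, so is [R b N] for every power [b] of 10, since
      such a [b] is 1 modulo 3.
    - If [m] and [N] are coprime, then so are [R b m] and [R b N]
      ([coprime_repunit]). Now [R b N] divides
      [R b (m * N) = R b m * R (b ^ m) N], hence it divides [R (b ^ m) N]
      ([dvdn_repunit_exp]); it is a proper divisor because the base is smaller.
      The case where [n.+1] and [k.+1] are coprime is [b = 10], [m = k.+1].
      When [k] is odd, write [10 ^ k.+1] as a square [b ^ 2]; an odd [n.+1] is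
      coprime to [m = 2], and an even one falls under the first case. *)

Definition repunit (b n : nat) : nat := \sum_(i < n) b ^ i.

Lemma E_repunit n k : E n k = repunit (10 ^ k.+1) n.+1.
Proof.
by rewrite /E big_mkord; apply: eq_bigr => i _; rewrite expnM.
Qed.

Lemma repunit0 b : repunit b 0 = 0.
Proof. exact: big_ord0. Qed.

Lemma repunitSr b n : repunit b n.+1 = repunit b n + b ^ n.
Proof. exact: big_ord_recr. Qed.

Lemma repunitS b n : repunit b n.+1 = 1 + b * repunit b n.
Proof.
rewrite /repunit big_ord_recl big_distrr /=; congr (_ + _).
by apply: eq_bigr => i _; rewrite -expnS.
Qed.

Lemma repunitD b m n : repunit b (m + n) = repunit b m + b ^ m * repunit b n.
Proof.
elim: n => [|n IHn]; first by rewrite repunit0 muln0 !addn0.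
by rewrite addnS !repunitSr IHn expnD mulnDr addnA.
Qed.

(** Cutting [m * n] ones into [n] blocks of length [m] turns each block into a
    digit [repunit b m] in base [b ^ m]. *)
Lemma repunitM b m n : repunit b (m * n) = repunit b m * repunit (b ^ m) n.
Proof.
elim: n => [|n IHn]; first by rewrite muln0 !repunit0 muln0.
by rewrite mulnS repunitD IHn repunitS mulnDr muln1 mulnCA.
Qed.

Lemma dvdn_repunit b m n : m %| n -> repunit b m %| repunit b n.
Proof. by case/dvdnP=> q ->; rewrite mulnC repunitM dvdn_mulr. Qed.

(** With a Bezout relation [u * m = v * n + 1], a common divisor of the two
    repunits divides both [repunit b (v * n)] and
    [repunit b (u * m) = 1 + b * repunit b (v * n)], hence divides 1. *)
Lemma coprime_repunit b m n :
  0 < m -> coprime m n -> coprime (repunit b m) (repunit b n).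
Proof.
move=> m_gt0 /eqP co_mn.
have [u v Duv _] := egcdnP n m_gt0.
rewrite /coprime -dvdn1; set g := gcdn _ _.
have g_um : g %| repunit b (u * m).
  by apply: dvdn_trans (dvdn_gcdl _ _) (dvdn_repunit _ _ _ (dvdn_mull u _)).
have g_vn : g %| repunit b (v * n).
  by apply: dvdn_trans (dvdn_gcdr _ _) (dvdn_repunit _ _ _ (dvdn_mull v _)).
by move: g_um; rewrite Duv co_mn addn1 repunitS dvdn_addl // dvdn_mull.
Qed.

Lemma dvdn_repunit_exp b m n :
  0 < m -> coprime m n -> repunit b n %| repunit (b ^ m) n.
Proof.
move=> m_gt0 co_mn; have := coprime_repunit b _ _ m_gt0 co_mn.
by rewrite coprime_sym => /Gauss_dvdr <-; rewrite -repunitM dvdn_repunit ?dvdn_mull.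
Qed.

Lemma repunit_mod b n d : b = 1 %[mod d] -> repunit b n = n %[mod d].
Proof.
move=> b1; elim: n => [|n IHn]; first by rewrite repunit0.
by rewrite repunitS -modnDmr -modnMm b1 modnMm mul1n IHn modnDmr.
Qed.

Lemma ltn_repunitl b c n : b < c -> 1 < n -> repunit b n < repunit c n.
Proof.
move=> lt_bc; case: n => [|[|n]] // _.
have le_r p : repunit b p <= repunit c p.
  by apply: leq_sum => -[[|i] _] _ //=; rewrite leq_exp2r // ltnW.
rewrite [repunit b _]repunitS [repunit c _]repunitS ltn_add2l.
apply: leq_trans (_ : c * repunit b n.+1 <= _); last by rewrite leq_mul.
by rewrite ltn_pmul2r // repunitS.
Qed.

Lemma ltn_repunitr b m n : 0 < b -> m < n -> repunit b m < repunit b n.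
Proof.
move=> b_gt0 /subnKC <-; rewrite repunitD repunitSr.
by rewrite -addnA -addn1 leq_add2l addn_gt0 expn_gt0 b_gt0.
Qed.

Lemma repunit_gt1 b n : 0 < b -> 1 < n -> 1 < repunit b n.
Proof.
move=> b_gt0; have {2}-> : 1 = repunit b 1 by rewrite repunitS repunit0 muln0.
exact: ltn_repunitr.
Qed.

Lemma composite_dvd d m : 1 < d < m -> d %| m -> composite m.
Proof.
case/andP=> d_gt1 lt_dm d_m; rewrite /composite (ltn_trans d_gt1 lt_dm) /=.
apply/negP=> /primeP[_ /(_ d d_m)/orP[]/eqP Dd].
  by rewrite Dd in d_gt1.
by rewrite Dd ltnn in lt_dm.
Qed.

Lemma composite_repunit_even b n :
  0 < b -> 2 < n -> ~~ odd n -> composite (repunit b n).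
Proof.
move=> b_gt0 n_gt2 n_even; apply: (composite_dvd (repunit b 2)).
  by rewrite repunit_gt1 ?ltn_repunitr.
by rewrite dvdn_repunit ?dvdn2.
Qed.

(** The divisor is [d] itself; it is proper since two ones in base [b >= d]
    already make [b + 1 > d]. *)
Lemma composite_repunit_mod b d n :
  b = 1 %[mod d] -> 1 < d <= b -> 1 < n -> d %| n -> composite (repunit b n).
Proof.
move=> b1 /andP[d_gt1 le_db] n_gt1 d_n; apply: (composite_dvd d).
  rewrite d_gt1 /=; apply: leq_ltn_trans le_db _.
  case: n n_gt1 {d_n} => [|[|n]] // _.
  by rewrite repunitS add1n ltnS leq_pmulr // repunitS.
by rewrite /dvdn repunit_mod.
Qed.

Lemma composite_repunit_exp b m n :
  1 < b -> 1 < m -> 1 < n -> coprime m n -> composite (repunit (b ^ m) n).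
Proof.
move=> b_gt1 m_gt1 n_gt1 co_mn; apply: (composite_dvd (repunit b n)).
  rewrite repunit_gt1 ?(ltnW b_gt1) //= ltn_repunitl //.
  by rewrite -{1}(expn1 b) ltn_exp2l.
by rewrite dvdn_repunit_exp // ltnW.
Qed.

Theorem theorem6 (n k : nat) (n_gt1 : 1 < n) (k_gt0 : 0 < k)
    (hnk : [\/ odd n, odd k, n + 1 = 0 %[mod 3] | gcdn (n + 1) (k + 1) = 1]) :
  composite (E n k).
Proof.
have n1_gt1 : 1 < n.+1 by apply: ltnW.
have b_gt0 : 0 < 10 ^ k.+1 by rewrite expn_gt0.
rewrite E_repunit; case: hnk => [n_odd | k_odd | n1_mod3 | co_nk].
- by apply: composite_repunit_even; rewrite //= n_odd.
- have [n1_odd | n1_even] := boolP (odd n.+1); last first.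
    exact: composite_repunit_even.
  have -> : 10 ^ k.+1 = (10 ^ uphalf k) ^ 2.
    by rewrite -expnM muln2 -[in LHS](odd_double_half k.+1) /= k_odd.
  apply: composite_repunit_exp; rewrite ?coprime2n //.
  by rewrite -{1}(expn0 10) ltn_exp2l // uphalf_gt0.
- have b_gt2 : 2 < 10 ^ k.+1 by apply: (@leq_trans (10 ^ 1)); rewrite ?leq_pexp2l.
  have b_mod3 : 10 ^ k.+1 = 1 %[mod 3].
    have mod10 : 10 %% 3 = 1 by [].
    by rewrite -modnXm mod10 exp1n.
  apply: composite_repunit_mod b_mod3 b_gt2 n1_gt1 _.
  by rewrite /dvdn -addn1 n1_mod3.
- apply: composite_repunit_exp => //.
  by rewrite coprime_sym /coprime -(addn1 n) -(addn1 k) co_nk.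
Qed.
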